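(* Let $G$ be a Sylow-cyclic group with maximum cyclic characteristic subgroup $\mu(G)$ and center $Z(G)$. Then $G$ has a unique element of order $2$ if and only if the center $Z(G)$ has even order.
   Context: A finite group $G$ is Sylow-cyclic if every Sylow subgroup of $G$ is cyclic. For a Sylow-cyclic group $G$, the product of all normal cyclic subgroups of $G$ is itself a cyclic characteristic subgroup of $G$; it contains every normal cyclic subgroup of $G$, is denoted $\mu(G)$, and is called the maximum (or maximal) cyclic characteristic subgroup of $G$. *)

(* Defs.v *)
From mathcomp Require Import all_boot all_fingroup all_solvable.

Set Implicit Arguments.
Unset Strict Implicit.
Unset Printing Implicit Defensive.

(* Main.v *)
Require Import Defs.
From mathcomp Require Import all_boot all_fingroup all_solvable.

Set Implicit Arguments.
Unset Strict Implicit.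
Unset Printing Implicit Defensive.

Import GroupScope.

(* A unique involution is fixed by conjugation, hence central. Conversely, a
   central involution generates a normal 2-subgroup, so it lies in every Sylow
   2-subgroup; these are cyclic, so each contains only one involution. *)

(** A cyclic group has at most one subgroup of each order, so [<[x]>] and [<[y]>] coincide, and a
    group of order 2 has a single nontrivial element. *)
Lemma cyclic_involution_inj (gT : finGroupType) (C : {group gT}) (x y : gT) :
  cyclic C -> x \in C -> y \in C -> #[x] = 2%N -> #[y] = 2%N -> x = y.
Proof.
move=> cycC Cx Cy ox oy.
have /eqP eq_xy : <[x]> :==: <[y]>.
  by rewrite (eq_subG_cyclic cycC) ?cycle_subG // -!orderE ox oy.
have : x \in <[y]> by rewrite -eq_xy cycle_id.
rewrite cycle2g // !inE => /orP[/eqP x1|/eqP //].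
by rewrite x1 order1 in ox.
Qed.

Lemma central_p_elt_Sylow (gT : finGroupType) (p : nat) (G P : {group gT})
    (x : gT) :
  p.-Sylow(G) P -> x \in 'Z(G) -> p.-elt x -> x \in P.
Proof.
move=> sylP Zx px; rewrite -cycle_subG (normal_sub_max_pgroup (Hall_max sylP)) //.
by rewrite sub_center_normal ?cycle_subG.
Qed.

Theorem corollary67 (gT : finGroupType) (G : {group gT}) (sylowCyclicG : Zgroup G) :
  (exists! x : gT, x \in G /\ #[x] = 2%N) <-> ~~ odd #|'Z(G)|.
Proof.
rewrite -dvdn2; split=> [[x [[Gx ox] uniq_x]] | even_Z].
  rewrite -ox order_dvdG //; apply/centerP; split=> // y Gy.
  by apply/commgP/conjg_fixP/esym/uniq_x; rewrite groupJ // orderJ.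
have [x Zx ox] := Cauchy (erefl : prime 2) even_Z.
have Gx : x \in G := subsetP (center_sub G) x Zx.
exists x; split=> // y [Gy oy].
have p2 (z : gT) : #[z] = 2%N -> 2.-elt z by rewrite /p_elt => ->.
(* The Sylow subgroup [P] is chosen around the arbitrary involution [y]; centrality then puts [x] in
   the same [P], where the two can be compared. *)
have [P sylP] : {P : {group gT} | 2.-Sylow(G) P & <[y]> \subset P}.
  by apply: Sylow_superset; [rewrite cycle_subG | exact: p2].
rewrite cycle_subG => Py.
have cycP : cyclic P.
  by have /forall_inP := sylowCyclicG; apply; exact: p_Sylow sylP.
apply: (cyclic_involution_inj cycP) => //.
exact: central_p_elt_Sylow sylP Zx (p2 x ox).
Qed.
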